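(* Let $C\subset E$ be a nonempty compact max-plus convex set and let $f:C\to E$ be a continuous function with respect to $\mathsf{D}_{\mathbf{hu}}$. If the metric $\mathsf{D}_{\mathbf{hu}}$ on $E$ is complete, then the following hold: (A) There exists $x_0\in C$ such that, for all $y\in C$, $\mathsf{D}_{\mathbf{hu}}(x_0,f(x_0))\le \mathsf{D}_{\mathbf{hu}}(y,f(x_0))$. (B) For $f$ to have a fixed point it is sufficient that, for all $x\in C$ such that $x\ne f(x)$, the set $C\cap[\![x,f(x)]\!]$ contains a point other than $x$.
   Context: $E\neq\{0\}$ is an Archimedean Riesz space (real vector lattice; Archimedean means that if $ny\leqslant x$ for all $n\in\mathbb{N}$ then $y\leqslant 0$), and $\mathbf{u}\in E_+$ is a unit: for every $x\in E_+$ there is $n\in\mathbb{N}$ with $x\leqslant n\mathbf{u}$. The topology on $E$ is that of the metric $\mathsf{D}_{\mathbf{hu}}(x,y)=\max\{0,\mathbf{p}_{\mathbf{u}}(x-y)\}+\max\{0,\mathbf{p}_{\mathbf{u}}(y-x)\}$, where $\mathbf{p}_{\mathbf{u}}(x)=\inf\{t\in\mathbb{R}:x\leqslant t\mathbf{u}\}$. The max-plus convex hull of a nonempty $S\subset E$ is the set $[\![S]\!]$ of all elements $(x_1+t_1\mathbf{u})\vee\cdots\vee(x_m+t_m\mathbf{u})$ with $m\ge1$, $x_i\in S$, $t_i\in\mathbb{R}$ and $\max_i t_i=0$; $[\![\emptyset]\!]=\emptyset$ and $[\![x,y]\!]=[\![\{x,y\}]\!]$. A set $C\subset E$ is max-plus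 convex if $C=[\![C]\!]$. *)

(* Defs.v *)
From HB Require Import structures.
From mathcomp Require Import all_boot all_order all_algebra.
From mathcomp Require Import all_classical all_reals all_analysis.

Set Implicit Arguments.
Unset Strict Implicit.
Unset Printing Implicit Defensive.

Import Order.TTheory GRing.Theory Num.Theory.

Local Open Scope classical_set_scope.
Local Open Scope ring_scope.

(* The order is carried at [ring_display], so that [<=] in [ring_scope] denotes
   the order of the space. The binary suprema and infima are operations of the
   structure; they give the [latticeType] instance that follows. *)
HB.mixin Record POrderedLmodule_isRiesz (R : realType) E
    of Num.POrderedZmodule E & GRing.Lmodule R E := {
  riesz_leD2r : forall z x y : E, x <= y -> x + z <= y + z ;
  riesz_scale_ge0 : forall (a : R) (x : E), 0 <= a -> 0 <= x -> 0 <= a *: x ;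
  riesz_inf : E -> E -> E ;
  riesz_sup : E -> E -> E ;
  riesz_infP : forall x y z : E, (x <= riesz_inf y z) = (x <= y) && (x <= z) ;
  riesz_supP : forall x y z : E, (riesz_sup x y <= z) = (x <= z) && (y <= z)
}.

#[short(type="rieszType")]
HB.structure Definition Riesz (R : realType) :=
  { E of Num.POrderedZmodule E & GRing.Lmodule R E
       & POrderedLmodule_isRiesz R E }.

HB.instance Definition _ (R : realType) (E : rieszType R) :=
  Order.POrder_MeetJoin_isLattice.Build ring_display E (@riesz_infP R E)
    (@riesz_supP R E).

HB.mixin Record Riesz_isArchimedeanUnital (R : realType) E of Riesz R E := {
  riesz_nontrivial : exists x : E, x <> 0 ;
  riesz_archimedean : forall x y : E, (forall n : nat, y *+ n <= x) -> y <= 0 ;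
  runit : E ;
  runit_ge0 : 0 <= runit ;
  runitP : forall x : E, 0 <= x -> exists n : nat, x <= runit *+ n
}.

(* Nonzero Archimedean Riesz spaces with a distinguished unit [runit]. *)
#[short(type="unitalRieszType")]
HB.structure Definition UnitalRiesz (R : realType) :=
  { E of Riesz R E & Riesz_isArchimedeanUnital R E }.

HB.instance Definition _ (R : realType) (E : unitalRieszType R) :=
  Order.Lattice.copy E (E : rieszType R).

Section hu_metric.
Context {R : realType} {E : unitalRieszType R}.
Implicit Types (x y z : E) (t : R).

Local Notation u := (runit : E).

(* [inf] is the real-valued infimum; the set is nonempty and bounded below,
   see [pu_has_inf]. *)
Definition pu x : R := inf [set t | x <= t *: u].

Definition Dhu x y : R := Num.max 0 (pu (x - y)) + Num.max 0 (pu (y - x)).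

Lemma riesz_subr_ge0 x y : (0 <= y - x) = (x <= y).
Proof.
apply/idP/idP => [/(riesz_leD2r x)|/(riesz_leD2r (- x))].
  by rewrite add0r subrK.
by rewrite subrr.
Qed.

Lemma riesz_leD x y z w : x <= y -> z <= w -> x + z <= y + w :> E.
Proof.
move=> xy zw; apply: le_trans (riesz_leD2r z _ _ xy) _.
by rewrite [y + z]addrC [y + w]addrC; apply: riesz_leD2r.
Qed.

Lemma riesz_leZ t x y : 0 <= t -> x <= y -> t *: x <= t *: y.
Proof.
move=> t0 xy; rewrite -riesz_subr_ge0 -scalerBr riesz_scale_ge0//.
by rewrite riesz_subr_ge0.
Qed.

Lemma runit_neq0 : u != 0.
Proof.
apply/eqP => u0; have [x] := @riesz_nontrivial R E; apply.
have le0 y : y <= 0.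
  apply: le_trans (leUl y 0) _.
  by have [n] := runitP _ (leUr (0 : E) y); rewrite u0 mul0rn.
apply/eqP; rewrite eq_le le0 /= -riesz_subr_ge0 subr0.
have := le0 (- x); rewrite -riesz_subr_ge0 opprK add0r; exact.
Qed.

Lemma runit_scale_ge0 t : (0 <= t *: u) = (0 <= t).
Proof.
apply/idP/idP => [tu|t0]; last exact: riesz_scale_ge0 t0 runit_ge0.
rewrite leNgt; apply/negP => t0; move/negP: runit_neq0; apply.
rewrite eq_le runit_ge0 andbT.
have := @riesz_leZ (- t^-1) _ _ _ tu.
rewrite scaler0 scalerA mulNr mulVf ?lt_eqF// scaleN1r oppr_ge0 invr_le0 ltW//.
by move=> /(_ isT); rewrite -riesz_subr_ge0 subr0 -[- u]sub0r riesz_subr_ge0.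
Qed.

Lemma runit_scale_le (s t : R) : (s *: u <= t *: u) = (s <= t).
Proof. by rewrite -riesz_subr_ge0 -scalerBl runit_scale_ge0 subr_ge0. Qed.

Lemma runit_dom x : exists n : nat, x <= n%:R *: u.
Proof.
have [n xn] := runitP _ (leUr (0 : E) x).
by exists n; rewrite scaler_nat; apply: le_trans xn; exact: leUl.
Qed.

Lemma pu_has_inf x : has_inf [set t | x <= t *: u].
Proof.
split; first by have [n xn] := runit_dom x; exists n%:R.
have [n xn] := runit_dom (- x); exists (- n%:R) => t /= xt.
rewrite -runit_scale_le scaleNr; apply: le_trans xt.
by rewrite -riesz_subr_ge0 opprK addrC -[x]opprK riesz_subr_ge0.
Qed.

Lemma le_pu x : x <= pu x *: u.
Proof.
rewrite -riesz_subr_ge0 -opprB -[- _]add0r riesz_subr_ge0.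
apply: (@riesz_archimedean R E u) => -[|n]; first by rewrite mulr0n runit_ge0.
have n0 : 0 < n.+1%:R^-1 :> R by rewrite invr_gt0 ltr0n.
have [t /= xt /ltW tp] := inf_adherent n0 (pu_has_inf x).
have uE : u = n.+1%:R *: (n.+1%:R^-1 *: u).
  by rewrite scalerA mulfV ?pnatr_eq0// scale1r.
rewrite -scaler_nat [leRHS]uE; apply: riesz_leZ => //.
rewrite -riesz_subr_ge0 opprB addrA -scalerDl riesz_subr_ge0.
by apply: le_trans xt _; rewrite runit_scale_le addrC.
Qed.

Lemma pu_leP x t : (pu x <= t) = (x <= t *: u).
Proof.
apply/idP/idP => [pt|xt]; last exact: ge_inf (pu_has_inf x).2 _ xt.
by apply: le_trans (le_pu x) _; rewrite runit_scale_le.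
Qed.

Lemma puD x y : pu (x + y) <= pu x + pu y.
Proof. by rewrite pu_leP scalerDl riesz_leD // le_pu. Qed.

Lemma pu0 : pu 0 = 0.
Proof.
apply/eqP; rewrite eq_le pu_leP scale0r lexx /=.
by rewrite -runit_scale_ge0 le_pu.
Qed.

Lemma Dhuxx x : Dhu x x = 0.
Proof. by rewrite /Dhu subrr pu0 maxxx addr0. Qed.

Lemma Dhu_positivity x y : Dhu x y = 0 -> x = y.
Proof.
move/eqP; rewrite /Dhu paddr_eq0 ?le_max ?lexx// => /andP[].
have H z w : Num.max 0 (pu (z - w)) == 0 -> z <= w.
  move=> /eqP h; have : pu (z - w) <= 0 by rewrite -h le_max lexx orbT.
  by rewrite pu_leP scale0r -riesz_subr_ge0 sub0r opprB riesz_subr_ge0.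
by move=> /H xy /H yx; apply/eqP; rewrite eq_le xy yx.
Qed.

Lemma Dhu_sym x y : Dhu x y = Dhu y x.
Proof. by rewrite /Dhu addrC. Qed.

Lemma Dhu_triangle y x z : Dhu x z <= Dhu x y + Dhu y z.
Proof.
have H a b c : Num.max 0 (pu (a - c)) <=
    Num.max 0 (pu (a - b)) + Num.max 0 (pu (b - c)).
  rewrite ge_max addr_ge0 ?le_max ?lexx//=.
  have -> : a - c = (a - b) + (b - c) by rewrite addrA subrK.
  by apply: le_trans (puD _ _) _; rewrite lerD// le_max lexx orbT.
by rewrite /Dhu addrACA lerD ?H// [leRHS]addrC H.
Qed.

End hu_metric.

(* From here on every [unitalRieszType] carries the topology, uniformity and
   metric given by [Dhu]. *)
HB.instance Definition _ (R : realType) (E : unitalRieszType R) :=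
  isMetric.Build R E (@Dhuxx R E) (@Dhu_positivity R E) (@Dhu_sym R E)
    (@Dhu_triangle R E).

Lemma mdist_Dhu (R : realType) (E : unitalRieszType R) (x y : E) :
  mdist x y = Dhu x y.
Proof. by []. Qed.

Definition seq_complete (R : realType) (T : metricType R) : Prop :=
  forall x : nat -> T, cauchy (x @ \oo) -> exists l : T, x @ \oo --> l.

Section maxplus.
Context {R : realType} {E : unitalRieszType R}.
Implicit Types (x y z : E) (S C : set E).

(* [E] has no least element, so the first term is used as the initial value of
   the iterated join (and of the iterated maximum); it is absorbed by
   idempotence. The families have [m.+1 >= 1] terms. *)
Definition maxplus_comb m (x : 'I_m.+1 -> E) (t : 'I_m.+1 -> R) : E :=
  \big[Order.join/x ord0 + t ord0 *: runit]_(i < m.+1) (x i + t i *: runit).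

Definition maxplus_hull S : set E :=
  [set z | exists m (x : 'I_m.+1 -> E) (t : 'I_m.+1 -> R),
     [/\ forall i, S (x i), \big[Num.max/t ord0]_(i < m.+1) t i = 0
       & z = maxplus_comb x t]].

Definition maxplus_segment x y : set E := maxplus_hull [set x; y].

Definition maxplus_convex C : Prop := C = maxplus_hull C.

End maxplus.

(* Main.v *)
Require Import Defs.
From mathcomp Require Import all_boot all_order all_algebra.
From mathcomp Require Import all_classical all_reals all_analysis.
From mathcomp Require Import ring lra zify.

Set Implicit Arguments.
Unset Strict Implicit.
Unset Printing Implicit Defensive.

Import Order.TTheory GRing.Theory Num.Theory.

(** Part (A) is a Ky Fan best approximation theorem for max-plus convexity, and
    contains Brouwer's fixed point theorem (every box of R^n is max-plus
    convex), so it needs a combinatorial substitute for degree theory.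

    Two facts make it work. Balls of [Dhu] are max-plus convex
    ([Dhu_maxplus_comb_le]); hence if x is a max-plus combination of those
    points y_g, g in G, that are nearest to f x among y_0, ..., y_n, then x is
    itself at least as close to f x as every y_i. And such an x exists up to
    any e > 0: colour a point x of the hull of the y_i by an index i for which
    y_i is nearest to f x; then [exists_rainbow_comb] finds an x that is
    essentially a combination of the y_g for g in a set G of colours all of
    which occur arbitrarily near x, and uniform continuity of f on C makes
    every y_g, g in G, almost nearest to f x ([exists_approx_nearest]). A
    cluster point of these approximate solutions, taken over all finite
    families in C and all e, is the point x0 of (A).

    The colouring theorem rests on a parity argument of Scarf
    ([exists_dominant_rainbow]): in a finite set with one linear order per
    colour, the dominant sets play the role of the simplices of a
    triangulation, so that no triangulation has to be constructed. It is
    applied to the points of the standard simplex with denominator K, ordered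
    along each coordinate. Besides grid points, the cells may contain slack
    elements, standing for the facets of the simplex: the grid points of a cell
    with slack element i have a small i-th coordinate. A coordinate that is
    small enough has no effect on the max-plus combination.

    For (B), moving from x along the segment towards y strictly decreases the
    distance to y ([segment_nearest]). So if f x0 differed from x0, a point of
    C other than x0 on the segment from x0 to f x0 would contradict the
    minimality of x0. *)

Local Open Scope classical_set_scope.
Local Open Scope ring_scope.

(** * Scarf's parity argument *)

Section Scarf.
Import fintype finset.
Local Open Scope nat_scope.
Local Open Scope set_scope.
Context {I U : finType}.
Variables (r : I -> U -> nat) (s : I -> U) (c : U -> I) (t0 : U).
Hypothesis r_inj : forall i, injective (r i).
Hypothesis slack_min : forall i y, r i (s i) <= r i y.
Hypothesis slack_max :
  forall i j y, i != j -> y \notin codom s -> r i y < r i (s j).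
Hypothesis color_slack : cancel s c.
Hypothesis proper_t0 : t0 \notin codom s.
Implicit Types (A B D : {set U}) (x y z : U) (i j k l : I).

Lemma slack_lt i y : y \notin codom s -> r i (s i) < r i y.
Proof.
move=> yT; rewrite ltn_neqAle slack_min andbT.
by apply: contra yT => /eqP/r_inj <-; apply: codom_f.
Qed.

(** No element is strictly above the minimum of [A] in all orders at once.
    Elements of a dominant set are minimal in it for some order, so its size is
    at most the number of orders; those of full size (rooms) are the analogues
    of the top-dimensional simplices of a triangulation, and those with one
    element less (doors) of their facets. *)
Definition dominant A : bool :=
  [forall y, exists i, forall x in A, r i y <= r i x].

Lemma dominantP A :
  reflect (forall y, exists i, forall x, x \in A -> r i y <= r i x)
          (dominant A).
Proof.
apply: (iffP forallP) => H y; have := H y.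
  by move=> /existsP[i /forall_inP Hi]; exists i.
by move=> [i Hi]; apply/existsP; exists i; apply/forall_inP.
Qed.

Lemma dominantS A B : A \subset B -> dominant B -> dominant A.
Proof.
move=> /subsetP AB /dominantP Bd; apply/dominantP => y.
by have [i Bi] := Bd y; exists i => x /AB; apply: Bi.
Qed.

(** Surjectivity of the minimiser [m] is what dominance adds: compared with
    itself, an element of [A] must be below all of [A] in some order. *)
Lemma dominant_argmin A x0 : x0 \in A -> dominant A ->
  exists m : I -> U, [/\ forall i, m i \in A,
    forall i x, x \in A -> r i (m i) <= r i x & codom m =i A].
Proof.
move=> x0A /dominantP Ad; pose m i := [arg min_(x < x0 in A) r i x].
have mA i : m i \in A by rewrite /m; case: arg_minnP.
have mmin i x : x \in A -> r i (m i) <= r i x.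
  by rewrite /m; case: arg_minnP => // y _; apply.
exists m; split=> // x; apply/codomP/idP => [[i ->]//|xA].
have [i xi] := Ad x; exists i.
by apply: (r_inj (i := i)); apply/eqP; rewrite eqn_leq mmin// xi.
Qed.

(** A boundary facet lies in one room: all slack elements except that of [l]
    can only be completed by the largest proper element for the order [l]. *)
Lemma card_outer_door l (D := [set s i | i in [set~ l]]) :
  #|[set y | (y \notin D) && dominant (y |: D)]| = 1.
Proof.
have [ym ymT ymmax] : exists2 y, y \notin codom s &
    forall z, z \notin codom s -> r l z <= r l y.
  case: (@arg_maxnP _ t0 (fun y => y \notin codom s) (r l)) => // y.
  by exists y.
have slackD k : k != l -> s k \in D.
  by move=> kl; apply/imsetP; exists k; rewrite ?inE.
have Dslack z : z \in D -> exists2 k, k != l & z = s k.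
  by move=> /imsetP[k]; rewrite !inE; exists k.
apply/eqP/cards1P; exists ym; apply/setP => y; rewrite !inE.
apply/andP/eqP => [[yD /dominantP dom]|->].
  have only_l z i : z \notin codom s ->
      (forall x, x \in y |: D -> r i z <= r i x) -> i = l.
    move=> zT Hi; apply/eqP; apply: contraT => /slackD siD.
    by have := Hi _ (setU1r y siD); rewrite leqNgt slack_lt.
  have yT : y \notin codom s.
    apply/negP => /codomP[k yk].
    have kl : k = l by apply/eqP; apply: contraNT yD => kl; rewrite yk slackD.
    have [i Hi] := dom t0; have il := only_l _ _ proper_t0 Hi.
    by have := Hi _ (setU11 y D); rewrite yk kl il leqNgt slack_lt.
  have [i Hi] := dom ym; have il := only_l _ _ ymT Hi.
  apply: (r_inj (i := l)); apply/eqP; rewrite eqn_leq ymmax//=.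
  by have := Hi _ (setU11 y D); rewrite il.
split; first by apply/negP => /Dslack[k _ e]; move: ymT; rewrite e codom_f.
apply/dominantP => z; have [/codomP[k ->]|zT] := boolP (z \in codom s).
  by exists k => x _.
exists l => x; rewrite !inE => /predU1P[->|/Dslack[k kl ->]].
  exact: ymmax.
by apply/ltnW/slack_max => //; rewrite eq_sym.
Qed.

(** An interior facet lies in exactly two rooms. With one element less than
    there are orders, [D] has exactly one pair of orders i <> j with the same
    minimiser. A new element y must take over the role of minimiser for i or for
    j, hence be above the minima of [D] in all other orders; dominance then
    forces y to be the largest such element for i, respectively j. *)
Lemma card_inner_door D x0 : x0 \in D -> x0 \notin codom s ->
  dominant D -> #|D|.+1 = #|I| ->
  #|[set y | (y \notin D) && dominant (y |: D)]| = 2.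
Proof.
move=> x0D x0T Dd Dc; have /dominantP domD := Dd.
have [m [mD mmin mDE]] := dominant_argmin x0D Dd.
pose above k y := [forall l, (l != k) ==> (r l (m l) < r l y)].
have aboveP k y : reflect (forall l, l != k -> r l (m l) < r l y) (above k y).
  exact: (iffP forall_inP).
have above_le k y : above k y -> forall x, x \in D -> r k y <= r k x.
  move=> /aboveP ay; have [i yi] := domD y; have [<-//|ik] := eqVneq i k.
  by have := ay _ ik; rewrite ltnNge yi.
have entering k k' : k != k' -> m k = m k' -> exists y, [/\ above k y,
    y \notin D, dominant (y |: D) & forall z, above k z -> r k z <= r k y].
  move=> kk' mkk'.
  (* an element can enter at k, since the slack element of k can *)
  have sk : above k (s k).
    apply/aboveP => l lk; apply: leq_ltn_trans (mmin l _ x0D) _.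
    exact: slack_max.
  case: (arg_maxnP (r k) sk) => y /[dup] ay /aboveP ayl ymax.
  exists y; split=> //.
    apply/negP => yD; move: (yD); rewrite -mDE => /codomP[l yl].
    have [lk|/ayl] := eqVneq l k; last by rewrite yl ltnn.
    by have := ayl k'; rewrite eq_sym kk' yl lk mkk' ltnn => /(_ isT).
  apply/dominantP => z; have [az|/aboveP naz] := boolP (above k z).
    exists k => x; rewrite !inE => /predU1P[->|]; first exact: ymax.
    exact: above_le.
  have [l lk zl] : exists2 l, l != k & r l z <= r l (m l).
    apply/exists_inP; apply: contraT => /exists_inPn H; case: naz => l lk.
    by rewrite ltnNge H.
  exists l => x; rewrite !inE => /predU1P[->|xD].
    exact: leq_trans zl (ltnW (ayl _ lk)).
  exact: leq_trans zl (mmin _ _ xD).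
have [i [j ij mij]] : exists i, exists2 j, i != j & m i = m j.
  apply/injectivePn/negP => /injectiveP /card_codom.
  by rewrite (eq_card mDE) -Dc => /n_Sn.
have [yi [ai yiD domi maxi]] := entering i j ij mij.
have ji : j != i by rewrite eq_sym.
have [yj [aj yjD domj maxj]] := entering j i ji (esym mij).
have yij : yi != yj.
  apply/eqP => e; have /aboveP/(_ j) := ai; rewrite eq_sym ij => /(_ isT).
  by rewrite e ltnNge above_le.
suff -> : [set y | (y \notin D) && dominant (y |: D)] = [set yi; yj].
  by rewrite cards2 yij.
apply/setP => y; rewrite !inE; apply/andP/orP => [[yD domy]|]; last first.
  by case=> /eqP ->.
(* In the room y |: D the minimisers v form a bijection; y is v k for one k,
   and v agrees with m elsewhere, so k is i or j. *)
have [v [vR vmin vRE]] := dominant_argmin (setU11 y D) domy.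
have v_inj : injective v.
  move=> a b; have /image_injP : #|codom v| == #|I|.
    by rewrite (eq_card vRE) cardsU1 yD add1n Dc.
  by apply.
have [k yk] : exists k, y = v k by apply/codomP; rewrite vRE setU11.
have vm l : l != k -> v l = m l.
  move=> lk; have vlD : v l \in D.
    have /setU1P[|//] := vR l; rewrite yk => /v_inj/eqP.
    by rewrite (negPf lk).
  apply: (r_inj (i := l)); apply/eqP; rewrite eqn_leq mmin// vmin//.
  by rewrite setU1r.
have ay : above k y.
  apply/aboveP => l lk; rewrite -vm// ltn_neqAle vmin ?setU11// andbT.
  by apply: contraNneq lk => /r_inj; rewrite yk => /v_inj ->.
have ymax z : above k z -> r k z <= r k y.
  move=> /aboveP az; have /dominantP/(_ z)[l zl] := domy.
  have [<-|lk] := eqVneq l k; first by rewrite zl// setU11.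
  by have := az _ lk; rewrite ltnNge zl// setU1r.
have [ki|ki] := eqVneq k i.
  left; apply/eqP/(r_inj (i := i))/eqP; rewrite ki in ay ymax.
  by rewrite eqn_leq maxi// ymax.
have [kj|kj] := eqVneq k j.
  right; apply/eqP/(r_inj (i := j))/eqP; rewrite kj in ay ymax.
  by rewrite eqn_leq maxj// ymax.
have : v i = v j by rewrite !vm// eq_sym.
by move=> /v_inj/eqP; rewrite (negPf ij).
Qed.

(** If removing x leaves exactly the colours other than [i0] and [A] is not
    rainbow, then the colour of x is repeated once in [A], and the two elements
    of that colour are the only ones that can be removed. *)
Lemma odd_card_colored_faces i0 A :
  #|A| = #|I| -> ~~ [forall i, i \in c @: A] ->
  odd #|[set x in A | c @: (A :\ x) == [set~ i0]]| = false.
Proof.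
move=> Ac cA; set F := [set x in A | _].
have card_face x : x \in A -> #|A :\ x| = #|[set~ i0]|.
  by move=> xA; have := cardsD1 x A; rewrite xA Ac cardsC1 => ->.
have face_inj x : x \in F -> {in A :\ x &, injective c}.
  rewrite inE => /andP[xA /eqP cx]; apply/imset_injP.
  by rewrite cx card_face.
have [->|[x xF]] := set_0Vmem F; first by rewrite cards0.
have /[!inE]/andP[xA /eqP cx] := xF.
have cxi0 : c x != i0.
  apply: contraNneq cA => cx0; apply/forallP => i.
  by rewrite -(finset.setD1K xA) imsetU1 cx cx0 !inE orbN.
have : c x \in c @: (A :\ x) by rewrite cx !inE.
move=> /imsetP[x' /[dup] x'A' /setD1P[x'x x'A] cxx'].
suff -> : F = [set x; x'] by rewrite cards2 eq_sym x'x.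
have x'F : x' \in F.
  rewrite inE x'A /= -cx; apply/eqP/setP => i; apply/imsetP/imsetP.
    move=> [z /setD1P[zx' zA] ->]; have [->|zx] := eqVneq z x.
      by exists x'.
    by exists z; rewrite // !inE zx.
  move=> [z /setD1P[zx zA] ->]; have [->|zx'] := eqVneq z x'.
    by exists x; rewrite // !inE eq_sym x'x.
  by exists z; rewrite // !inE zx'.
apply/setP => z; rewrite finset.in_set2; apply/idP/orP => [zF|].
  have [_|zx] := eqVneq z x; first by left.
  have [_|zx'] := eqVneq z x'; first by right.
  have := face_inj _ zF x x'; rewrite !inE xA x'A ![_ == z]eq_sym zx zx'.
  by move=> /(_ isT isT cxx') e; rewrite e eqxx in x'x.
by case=> /eqP ->.
Qed.

(** Sperner's double count. Count the pairs of a door carrying all colours but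
    one colour [i0] and a room containing it. Each such door lies in two rooms,
    except a single one formed by slack elements, so the count is odd; without a
    rainbow room each room would contribute an even number. *)
Theorem exists_dominant_rainbow :
  exists2 A, dominant A & forall i, exists2 x, x \in A & c x = i.
Proof.
suff [A Ad /forallP cA] : exists2 A, dominant A & [forall i, i \in c @: A].
  by exists A => // i; have /imsetP[x xA ->] := cA i; exists x.
apply/exists_inP; apply: contraT => /exists_inPn norainbow.
pose i0 := c t0.
pose door D := [&& dominant D, #|D|.+1 == #|I| & c @: D == [set~ i0]].
pose room A := dominant A && (#|A| == #|I|).
pose outer := [set s i | i in [set~ i0]].
have count : \sum_(D | door D) \sum_(y | (y \notin D) && dominant (y |: D)) 1
   = \sum_(A | room A) \sum_(x | (x \in A) && (c @: (A :\ x) == [set~ i0])) 1.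
  rewrite !pair_big_dep /=.
  rewrite (reindex_onto (fun p => (p.1 :\ p.2, p.2))
    (fun p => (p.2 |: p.1, p.2))) /=; last first.
    by move=> [D y] /= /and3P[_ yD _]; rewrite finset.setU1K.
  apply: eq_bigl => -[A x] /=; rewrite xpair_eqE eqxx andbT.
  have [xA|xA] := boolP (x \in A); last first.
    rewrite !andbF; apply/negbTE; apply: contra xA => /andP[_ /eqP <-].
    exact: setU11.
  rewrite /door /room finset.setD1K// eqxx setD11 andbT (cardsD1 x A) xA add1n.
  have [dA|] := boolP (dominant A); last by rewrite !andbF.
  by rewrite (dominantS (finset.subsetDl _ _) dA) !andbT.
have outerE D : door D -> (D == outer) = (D \subset codom s).
  move=> /and3P[_ _ /eqP cD]; apply/eqP/subsetP => [-> x /imsetP[i _ ->]|Ds].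
    exact: codom_f.
  apply/setP => x; apply/idP/imsetP => [xD|[i + ->]].
    have /codomP[i xi] := Ds _ xD; exists i => //.
    by rewrite -cD; apply/imsetP; exists x; rewrite // xi color_slack.
  rewrite -cD => /imsetP[z zD ->]; have /codomP[j zj] := Ds _ zD.
  by rewrite zj color_slack -zj.
have door_outer : door outer.
  apply/and3P; split.
  - apply/dominantP => y.
    have [/codomP[k ->]|yT] := boolP (y \in codom s); first by exists k.
    exists i0 => x /imsetP[k]; rewrite !inE => ki ->.
    by apply/ltnW/slack_max => //; rewrite eq_sym.
  - rewrite card_imset ?cardsC1; last exact: can_inj color_slack.
    by rewrite prednK//; apply/card_gt0P; exists i0.
  - apply/eqP/setP => i; apply/imsetP/idP => [[x /imsetP[k ki ->] ->]|ii0].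
      by rewrite color_slack.
    by exists (s i); rewrite ?color_slack//; apply/imsetP; exists i.
have odd_left : odd (\sum_(D | door D)
    \sum_(y | (y \notin D) && dominant (y |: D)) 1).
  rewrite (bigD1 outer)//= oddD sum1dep_card card_outer_door /=.
  rewrite (big_morph odd oddD (erefl (odd 0))) big1// => D /andP[/[dup] dD].
  move=> /and3P[Dd /eqP Dc _]; rewrite outerE// => /subsetPn[x xD xT].
  by rewrite sum1dep_card (card_inner_door xD xT).
suff : odd (\sum_(A | room A)
    \sum_(x | (x \in A) && (c @: (A :\ x) == [set~ i0])) 1) = false.
  by rewrite -count odd_left.
rewrite (big_morph odd oddD (erefl (odd 0))) big1// => A /andP[Ad /eqP Ac].
by rewrite sum1dep_card odd_card_colored_faces// norainbow.
Qed.

End Scarf.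

(** * Colourings of the grid points of a simplex *)

Section Grid.
Import fintype finset.
Local Open Scope nat_scope.
Local Open Scope set_scope.

(** A function with sum [K] is a point of the n-simplex scaled by [K]. Every
    colour either occurs within distance n of the point w, or is a coordinate in
    which w is at most n. Nothing is assumed on the colouring at the boundary:
    the second alternative replaces Sperner's boundary condition. *)
Lemma exists_rainbow_cell n K (c : ('I_n.+1 -> nat) -> 'I_n.+1) :
  exists2 w : 'I_n.+1 -> nat, \sum_i w i = K &
    forall i, w i <= n \/ exists v : 'I_n.+1 -> nat,
      [/\ \sum_j v j = K, c v = i &
          forall j, v j <= w j + n /\ w j <= v j + n].
Proof.
pose T := {w : {ffun 'I_n.+1 -> 'I_K.+1} | \sum_i w i == K :> nat}.
pose val_at (w : T) (i : 'I_n.+1) : nat := val w i.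
have sumT w : \sum_i val_at w i = K by exact: (eqP (valP w)).
have mkT (y : 'I_n.+1 -> nat) : \sum_i y i = K ->
    exists w : T, forall i, val_at w i = y i.
  move=> yK; have yle i : y i <= K by rewrite -yK (bigD1 i)//= leq_addr.
  pose w := [ffun i => inord (y i)] : {ffun 'I_n.+1 -> 'I_K.+1}.
  have wE i : w i = y i :> nat by rewrite ffunE inordK// ltnS.
  have wK : \sum_i w i == K :> nat by rewrite (eq_bigr y) ?yK.
  by exists (exist _ w wK).
have [t0 _] : exists w : T, forall i, val_at w i = if i == ord0 then K else 0.
  by apply: mkT; rewrite -big_mkcond big_pred1_eq.
pose N := #|{: T}|.
(* Coordinate i decides the order r i, with enum_rank breaking ties; the slack
   element inr i is at the bottom and the other slack elements at the top. *)
pose r (i : 'I_n.+1) (x : T + 'I_n.+1) : nat := match x with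
  | inl w => (val_at w i * N + enum_rank w).+1
  | inr j => if i == j then 0 else (K.+1 * N + j).+1 end.
have rle i (w v : T) : r i (inl w) <= r i (inl v) -> val_at w i <= val_at v i.
  rewrite /r ltnS => le; rewrite leqNgt; apply/negP => lt.
  have := leq_trans (leq_addr _ _) le; rewrite leqNgt => /negP; apply.
  apply: leq_trans (leq_mul lt (leqnn N)).
  by rewrite mulSn addnC ltn_add2r ltn_ord.
have rlt i (w : T) : r i (inl w) <= K.+1 * N.
  rewrite mulSn addnC /r -addnS; apply: leq_add; last exact: ltn_ord.
  by rewrite leq_mul2r orbC -ltnS ltn_ord.
have r_inj i : injective (r i).
  move=> [w|j] [v|k] /= e.
  - have ewv : val_at w i = val_at v i.
      by apply/eqP; rewrite eqn_leq !rle// /r e.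
    by move: e; rewrite ewv => -[] /addnI/val_inj/enum_rank_inj ->.
  - move: e (rlt i w) => /=; case: (i == k) => [//|->].
    by rewrite ltnNge leq_addr.
  - move: e (rlt i v) => /=; case: (i == j) => [//|<-].
    by rewrite ltnNge leq_addr.
  - move: e; case: (eqVneq i j) (eqVneq i k) => [<-|_] [<-|_] //.
    by case=> /addnI/val_inj ->.
have proper (w : T) : inl w \notin codom (@inr T 'I_n.+1).
  by apply/codomP => -[].
pose color (x : T + 'I_n.+1) :=
  match x with inl w => c (val_at w) | inr j => j end.
have [|||A /dominantP Ad Arb] :=
    @exists_dominant_rainbow _ _ r inr color (inl t0) r_inj _ _ _ (proper t0).
- by move=> i y; rewrite /= eqxx.
- move=> i j [w|k] ij; last by rewrite codom_f.
  move=> _; apply: leq_ltn_trans (rlt i w) _.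
  by rewrite /= (negPf ij) ltnS leq_addr.
- by [].
have dom (y : T) : exists2 i, inr i \notin A &
    forall w, inl w \in A -> val_at y i <= val_at w i.
  have [i Hi] := Ad (inl y); exists i; last by move=> w /Hi /rle.
  by apply/negP => /Hi; rewrite /= eqxx.
have [w0 w0A] : exists w, inl w \in A.
  have [l lA _] := dom t0; have [[w|k] xA /= e] := Arb l; first by exists w.
  by rewrite -e xA in lA.
pose L := [pred i | inr i \notin A].
pose m i := val_at [arg min_(w < w0 | inl w \in A) val_at w i] i.
have mle i w : inl w \in A -> m i <= val_at w i.
  by rewrite /m; case: arg_minnP => // v _; apply.
have mex i : exists2 w, inl w \in A & m i = val_at w i.
  by rewrite /m; case: arg_minnP => // v vA _; exists v.
(* Otherwise m + 1 on L could be completed to a grid point above the cell in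
   every direction of L, against dominance. *)
have sumL : K < \sum_(i in L) (m i).+1.
  rewrite ltnNge; apply/negP => le; have [l lL _] := dom t0.
  pose y i := (if i \in L then (m i).+1 else 0) +
    (if i == l then K - \sum_(i in L) (m i).+1 else 0).
  have [|v vy] := mkT y.
    by rewrite big_split /= -!big_mkcond big_pred1_eq subnKC.
  have [i iL vi] := dom v; have [w wA mw] := mex i.
  have := vi _ wA; rewrite vy -mw /y inE iL leqNgt => /negP; apply.
  by rewrite addSn ltnS leq_addr.
have cardL : #|L| <= n.+1 by rewrite -[leqRHS]card_ord max_card.
have sumLE : \sum_(i in L) (m i).+1 = \sum_(i in L) m i + #|L|.
  by rewrite -sum1_card -big_split /=; apply: eq_bigr => i _; rewrite addn1.
(* As the minima m on L already use up all but n of the total K, the coordinates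
   of a point of the cell exceed them, or 0 outside L, by at most n. *)
have close w i : inl w \in A -> val_at w i <= (if i \in L then m i else 0) + n.
  move=> wA; have lemw (P : pred 'I_n.+1) :
      \sum_(j | P j) m j <= \sum_(j | P j) val_at w j.
    by apply: leq_sum => j _; apply: mle.
  rewrite -ltnS -addnS; apply: leq_trans (leq_add (leqnn _) cardL).
  rewrite -(ltn_add2r (\sum_(j in L | j != i) m j)).
  have sumw : val_at w i + \sum_(j in L | j != i) m j <= K.
    rewrite -[leqRHS](sumT w) [leqRHS](bigD1 i)//= leq_add2l.
    apply: leq_trans (lemw _) _; rewrite [leqRHS](bigID (mem L))/=.
    rewrite (eq_bigl (fun j => (j != i) && (j \in L))) ?leq_addr// => j.
    by rewrite andbC.
  apply: leq_ltn_trans sumw _; apply: leq_trans sumL _; rewrite sumLE.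
  have [iL|iL] := boolP (i \in L); first by rewrite (bigD1 i)//= addnAC.
  rewrite add0n addnC leq_add2l; apply: eq_leq; apply: eq_bigl => j.
  by have [->|] := eqVneq j i; rewrite ?andbT// (negPf iL).
exists (val_at w0); first exact: sumT.
move=> i; have [iL|iL] := boolP (i \in L); last first.
  by left; have := close _ i w0A; rewrite (negPf iL) add0n.
right; have [[w|k] wA /= e] := Arb i; last by move: iL; rewrite inE -e wA.
have close2 u v j : inl u \in A -> inl v \in A -> val_at u j <= val_at v j + n.
  move=> uA vA; apply: leq_trans (close _ j uA) _.
  by rewrite leq_add2r; case: ifP => // _; apply: mle.
by exists (val_at w); split=> // j; split; apply: close2.
Qed.

End Grid.

(** * Max-plus combinations and the metric *)

Section Comb.
Context {R : realType} {E : unitalRieszType R}.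
Implicit Types (x y z : E) (t d : R) (C S : set E).

Local Notation u := (runit : E).
Local Notation pos_pu z := (Num.max 0 (pu z)).

Lemma pos_pu_ge0 z : 0 <= pos_pu z.
Proof. by rewrite le_max lexx. Qed.

Lemma riesz_lerBlDl x y z : (x - y <= z) = (x <= y + z).
Proof.
by rewrite -[LHS]riesz_subr_ge0 -[RHS]riesz_subr_ge0 opprB addrCA addrA.
Qed.

Lemma pos_pu_leP x y d : 0 <= d -> (pos_pu (x - y) <= d) = (x <= y + d *: u).
Proof. by move=> d0; rewrite ge_max d0 pu_leP riesz_lerBlDl. Qed.

Lemma le_pos_pu x y : x <= y + pos_pu (x - y) *: u.
Proof. by rewrite -pos_pu_leP ?pos_pu_ge0. Qed.

Lemma le_addZu x s t : s <= t -> x + s *: u <= x + t *: u.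
Proof. by move=> st; apply: riesz_leD; rewrite ?runit_scale_le. Qed.

Lemma addZu_le x t : t <= 0 -> x + t *: u <= x.
Proof. by move=> t0; rewrite -[leRHS]addr0 -(scale0r u) le_addZu. Qed.

Lemma le_addZuDl x y s t : x + s *: u <= y -> x + (s + t) *: u <= y + t *: u.
Proof. by move=> xy; rewrite scalerDl addrA riesz_leD. Qed.

Lemma le_addZuDr x y s t : x <= y + s *: u -> x + t *: u <= y + (s + t) *: u.
Proof. by move=> xy; rewrite scalerDl addrA riesz_leD. Qed.

Lemma le_maxplus_comb m (x : 'I_m.+1 -> E) (t : 'I_m.+1 -> R) i :
  x i + t i *: u <= maxplus_comb x t.
Proof.
rewrite /maxplus_comb; have := mem_index_enum i.
elim: (index_enum _) => //= j r IH; rewrite big_cons in_cons.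
by move=> /predU1P[->|/IH]; [exact: leUl|exact: lexUr].
Qed.

Lemma maxplus_comb_le m (x : 'I_m.+1 -> E) (t : 'I_m.+1 -> R) z :
  (forall i, x i + t i *: u <= z) -> maxplus_comb x t <= z.
Proof.
move=> H; apply: (big_ind (fun a => a <= z)) => // a b az bz.
by rewrite leUx az.
Qed.

Lemma maxplus_hull_comb S m (x : 'I_m.+1 -> E) (t : 'I_m.+1 -> R) j :
  (forall i, S (x i)) -> (forall i, t i <= 0) -> t j = 0 ->
  maxplus_hull S (maxplus_comb x t).
Proof.
move=> Sx t0 tj; exists m, x, t; split=> //; apply/eqP; rewrite eq_le.
by rewrite bigmax_le //= -[leLHS]tj le_bigmax.
Qed.

Lemma bigmax_eq0P m (t : 'I_m.+1 -> R) :
  \big[Num.max/t ord0]_(i < m.+1) t i = 0 ->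
  (forall i, t i <= 0) /\ exists j, t j = 0.
Proof.
move=> t0; split=> [i|]; first by rewrite -t0 le_bigmax.
rewrite -t0; apply: (big_ind (fun a => exists j, t j = a)).
- by exists ord0.
- by move=> a b [i <-] [j <-]; case: leP => _; [exists j|exists i].
- by move=> i _; exists i.
Qed.

Lemma maxplus_hullS S C : S `<=` C -> maxplus_hull S `<=` maxplus_hull C.
Proof.
by move=> SC z [m [x [t [Sx t0 ->]]]]; exists m, x, t; split=> // i; apply: SC.
Qed.

Lemma Dhu_le x z a b : 0 <= a -> 0 <= b ->
  x <= z + a *: u -> z <= x + b *: u -> Dhu x z <= a + b.
Proof. by move=> a0 b0 xz zx; apply: lerD; rewrite pos_pu_leP. Qed.

(** Balls are max-plus convex, in a form that ignores the terms dominated by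
    those with index in [G]. Let g in [G] have the highest term relative to z.
    It bounds the excess of the combination over z, while raising that
    combination by the excess of z over [x g], minus [t g], brings it above z:
    in the sum of the two bounds [t g] cancels. If the combination does not
    exceed z, only the second excess counts, and the term [g0] of coefficient 0
    bounds it. *)
Lemma Dhu_maxplus_comb_le m (x : 'I_m.+1 -> E) (t : 'I_m.+1 -> R)
    (G : pred 'I_m.+1) z (d : R) g0 :
  (forall i, t i <= 0) -> G g0 -> t g0 = 0 ->
  (forall i, exists2 g, G g & x i + t i *: u <= x g + t g *: u) ->
  (forall g, G g -> Dhu (x g) z <= d) ->
  Dhu (maxplus_comb x t) z <= d.
Proof.
move=> t0 Gg0 tg0 Gdom Gd; set w := maxplus_comb x t.
pose a i := pu (x i - z) + t i.
have [g Gg amax] : exists2 g, G g & forall i, G i -> a i <= a g.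
  by case: (arg_maxP a Gg0) => g Gg amax; exists g.
have above : w <= z + a g *: u.
  apply: maxplus_comb_le => i; have [h Gh ih] := Gdom i.
  apply: le_trans ih (le_trans _ (le_addZu _ (amax _ Gh))).
  by apply: le_addZuDr; rewrite -riesz_lerBlDl le_pu.
have below h : z <= w + (pos_pu (z - x h) - t h) *: u.
  apply: le_trans (le_pos_pu z (x h)) _.
  rewrite -[X in x h + X *: u](subrKC (t h)).
  by apply: le_addZuDl; apply: le_maxplus_comb.
have [ag|ag] := leP (a g) 0.
  apply: le_trans (Gd _ Gg0); apply: le_trans (_ : 0 + pos_pu (z - x g0) <= _).
    apply: Dhu_le; rewrite ?pos_pu_ge0//.
      by apply: le_trans above _; apply: le_addZu.
    by have := below g0; rewrite tg0 subr0.
  by rewrite lerD2r pos_pu_ge0.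
apply: le_trans (Gd _ Gg).
apply: le_trans (_ : a g + (pos_pu (z - x g) - t g) <= _).
  apply: Dhu_le => //; first exact: ltW.
  by rewrite subr_ge0 (le_trans (t0 g)) ?pos_pu_ge0.
by rewrite /a addrACA subrr addr0 lerD2r le_max lexx orbT.
Qed.

Lemma Dhu_maxplus_comb2_le m (x : 'I_m.+1 -> E) (s t : 'I_m.+1 -> R) (d : R) :
  0 <= d -> (forall i, s i <= t i + d) -> (forall i, t i <= s i + d) ->
  Dhu (maxplus_comb x s) (maxplus_comb x t) <= d + d.
Proof.
have half a b : (forall i, a i <= b i + d) ->
    maxplus_comb x a <= maxplus_comb x b + d *: u.
  move=> ab; apply: maxplus_comb_le => i.
  apply: le_trans (le_addZu _ (ab i)) _.
  by apply: le_addZuDl; apply: le_maxplus_comb.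
by move=> d0 st ts; apply: Dhu_le => //; apply: half.
Qed.

Lemma nbhs_Dhu x d : 0 < d -> nbhs x [set y | Dhu x y < d].
Proof. by move=> d0; have := nbhsx_ballx x d d0; rewrite ballEmdist. Qed.

Lemma continuous_Dhu C (f : E -> E) x e : {within C, continuous f} -> C x ->
  0 < e -> exists2 d, 0 < d &
    forall y, C y -> Dhu x y < d -> Dhu (f x) (f y) < e.
Proof.
move=> /subspace_continuousP cf Cx e0.
have /metricType_numDomainType.cvgrPdist_lt/(_ _ e0) := cf _ Cx.
rewrite near_withinE => /metricType_numDomainType.nbhs_mdistP[d d0 dP].
by exists d => // y Cy xy; apply: dP.
Qed.

Lemma compact_unif_Dhu C (f : E -> E) e : {within C, continuous f} ->
  compact C -> 0 < e -> exists2 d, 0 < d &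
    forall x y, C x -> C y -> Dhu x y < d -> Dhu (f x) (f y) < e.
Proof.
move=> cf /compact_near_coveringP cC e0.
pose P d x := C x -> forall y, C y -> Dhu x y < d -> Dhu (f x) (f y) < e.
have /cC : forall x, C x -> \forall x' \near x & d \near 0^'+, P d x'.
  move=> x Cx; have [|d d0 dP] := continuous_Dhu cf Cx (_ : 0 < e / 2).
    by rewrite divr_gt0.
  exists ([set y | Dhu x y < d / 2], [set t | t < d / 2]).
    split; first by apply: nbhs_Dhu; rewrite divr_gt0.
    by apply: nbhs_right_lt; rewrite divr_gt0.
  move=> [x' t] /= [xx' td] Cx' y Cy x'y.
  rewrite (splitr e); apply: le_lt_trans (Dhu_triangle (f x) _ _) _.
  apply: ltrD.
    rewrite Dhu_sym; apply: dP => //; apply: lt_trans xx' _.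
    by rewrite ltr_pdivrMr// ltr_pMr// ltr1n.
  apply: dP => //; apply: le_lt_trans (Dhu_triangle x' _ _) _.
  by rewrite (splitr d) ltrD// (lt_trans x'y).
move=> cov; near (0 : R)^'+ => d; exists d => // x y Cx Cy.
by move: x Cx (Cx) y Cy; near: d.
Unshelve. all: by end_near. Qed.

(** * Nearest points *)

(** The last conclusion says that x behaves as a combination of the [y g], g in
    [G], alone. With N = n + 1, a grid point w of the simplex gives the
    coefficients a (w i - max w). As the maximum of w is at least K / N, the
    slope a = 2 N M / K makes the coefficient at most - M as soon as w i <= n
    and 2 N^2 <= K; since M bounds all differences y i - y j, the term i is then
    dominated. The coefficients of two neighbouring grid points differ by at
    most 2 N a, which tends to 0 as K grows. *)
Lemma exists_rainbow_comb n (y : 'I_n.+1 -> E) (c : E -> 'I_n.+1) (d : R) :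
  0 < d -> exists (x : E) (G : pred 'I_n.+1),
    [/\ maxplus_hull (range y) x,
        forall g, G g -> exists2 x', maxplus_hull (range y) x' &
          Dhu x x' < d /\ c x' = g
      & forall z b, (forall g, G g -> Dhu (y g) z <= b) -> Dhu x z <= b].
Proof.
move=> d0; pose N := n.+1.
pose M := \big[Num.max/1]_(p : 'I_N * 'I_N) pu (y p.1 - y p.2).
have M0 : 0 < M by apply: lt_le_trans ltr01 (bigmax_ge_id _ _ _ _).
have yM i j : y i <= y j + M *: u.
  rewrite -riesz_lerBlDl -pu_leP.
  exact: (le_bigmax _ (fun p : 'I_N * 'I_N => pu (y p.1 - y p.2)) (i, j)).
have [K [Kge Kd]] : exists K, (2 * N * N <= K)%N /\
    8%:R * N%:R ^+ 2 * M / K%:R < d.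
  exists (maxn (2 * N * N) (Num.trunc (8%:R * N%:R ^+ 2 * M / d)).+1).
  split; first exact: leq_maxl.
  rewrite ltr_pdivrMr ?ltr0n ?leq_max ?orbT// [ltRHS]mulrC -ltr_pdivrMr//.
  by apply: lt_le_trans (truncnS_gt _) _; rewrite ler_nat leq_maxr.
have K0 : 0 < K%:R :> R by rewrite ltr0n (leq_trans _ Kge).
pose a := 2%:R * N%:R * M / K%:R.
have a0 : 0 <= a by rewrite divr_ge0 ?mulr_ge0 // ltW.
pose t (w : 'I_N -> nat) i := a * ((w i)%:R - (\max_j w j)%:R).
have t0 w i : t w i <= 0.
  by rewrite mulr_ge0_le0// subr_le0 ler_nat leq_bigmax.
have maxw (w : 'I_N -> nat) : exists j, w j = \max_i w i.
  have [|j wj] := bigop.eq_bigmax w; first by rewrite card_ord.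
  by exists j.
have hullt w : maxplus_hull (range y) (maxplus_comb y (t w)).
  have [j wj] := maxw w; apply: (maxplus_hull_comb (j := j)) => //.
  by rewrite /t wj subrr mulr0.
have [w wK wc] := exists_rainbow_cell K (fun w => c (maxplus_comb y (t w))).
have [j wj] := maxw w.
have Kw : (K <= N * w j)%N.
  rewrite -wK wj.
  have -> : (N * \max_i w i = \sum_(k < N) \max_i w i)%N.
    by rewrite sum_nat_const card_ord.
  by apply: leq_sum => i _; exact: leq_bigmax.
have wjn : (2 * N <= w j)%N.
  by rewrite -(leq_pmul2r (ltn0Sn n)) (leq_trans Kge)// mulnC.
have nw : (n < w j)%N by rewrite (leq_trans _ wjn)// mulSn leq_addr.
exists (maxplus_comb y (t w)), [pred i | n < w i]%N; split=> //.
- move=> g /= wg; have [|[v [vK vg vw]]] := wc g; first by rewrite leqNgt wg.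
  exists (maxplus_comb y (t v)); first exact: hullt.
  split=> //; apply: le_lt_trans Kd.
  pose b := a * (2 * N)%:R.
  have close (p q : 'I_N -> nat) : (forall i, p i <= q i + n)%N ->
      (forall i, q i <= p i + n)%N -> forall i, t p i <= t q i + b.
    move=> pq qp i; rewrite /t -mulrDr ler_wpM2l//.
    have qp_max : (\max_k q k <= \max_k p k + n)%N.
      apply/bigmax_leqP => k _; apply: leq_trans (qp k) _.
      by rewrite leq_add2r leq_bigmax.
    have : (p i + \max_k q k <= q i + (2 * N) + \max_k p k)%N.
      by move: (pq i) qp_max; rewrite /N; lia.
    by rewrite -(ler_nat R) !natrD; lra.
  have -> : 8%:R * N%:R ^+ 2 * M / K%:R = b + b.
    by rewrite /b /a natrM; field; rewrite gt_eqF.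
  apply: Dhu_maxplus_comb2_le; first by rewrite mulr_ge0.
  + by apply: close => i; have [] := vw i.
  + by apply: close => i; have [] := vw i.
- move=> z b Gb; apply: (Dhu_maxplus_comb_le (g0 := j) _ _ _ _ Gb) => //=.
  + by rewrite /t wj subrr mulr0.
  move=> i; have [wi|wi] := ltnP n (w i); first by exists i.
  exists j; first exact: nw.
  have -> : t w j = 0 by rewrite /t wj subrr mulr0.
  rewrite scale0r addr0; apply: le_trans (riesz_leD2r _ _ _ (yM i j)) _.
  rewrite -addrA -scalerDl; apply: addZu_le.
  rewrite /t -wj -opprB mulrN subr_le0.
  rewrite /a mulrAC ler_pdivlMr// mulrAC mulrC ler_wpM2r ?(ltW M0)//.
  rewrite -natrB ?(leq_trans wi (ltnW nw))// -!natrM ler_nat.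
  have Nwi : (N * w i <= N * N)%N by rewrite leq_mul2l ltnW.
  have Nwj : (N * (2 * N) <= N * w j)%N by rewrite leq_mul2l wjn.
  rewrite -mulnA mulnBr; move: Nwi Nwj Kw; rewrite mulnCA.
  by move: (N * N)%N (N * w i)%N (N * w j)%N => A B D; lia.
Qed.

Lemma exists_approx_nearest C (f : E -> E) n (y : 'I_n.+1 -> E) (e : R) :
  compact C -> maxplus_convex C -> {within C, continuous f} ->
  (forall i, C (y i)) -> 0 < e ->
  exists2 x, C x & forall i, Dhu x (f x) <= Dhu (y i) (f x) + e.
Proof.
move=> cC hC cf Cy e0; have e20 : 0 < e / 2 by rewrite divr_gt0.
have [d d0 fd] := compact_unif_Dhu cf cC e20.
have hullC : maxplus_hull (range y) `<=` C.
  by rewrite [X in _ `<=` X]hC; apply: maxplus_hullS => _ [i _ <-].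
pose c x := [arg min_(i < ord0 : 'I_n.+1) Dhu (y i) (f x)]%O.
have cmin x i : Dhu (y (c x)) (f x) <= Dhu (y i) (f x).
  by rewrite /c; case: arg_minP => // j _; apply.
have [x [G [/hullC Cx Gx ball]]] := exists_rainbow_comb y c d0.
exists x => // i; apply: ball => g /Gx[x' /hullC Cx' [xx' <-]].
have fxx' := ltW (fd _ _ Cx Cx' xx').
have := Dhu_triangle (f x') (y (c x')) (f x); rewrite (Dhu_sym (f x')).
have := Dhu_triangle (f x) (y i) (f x'); have := cmin x' i.
lra.
Qed.

(** The sets of approximate solutions for finite families of points of C form a
    filter base on C, and a cluster point satisfies all inequalities by
    continuity of f. *)
Lemma exists_nearest C (f : E -> E) :
  C !=set0 -> compact C -> maxplus_convex C -> {within C, continuous f} ->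
  exists2 x, C x & forall y, C y -> Dhu x (f x) <= Dhu y (f x).
Proof.
move=> [y0 Cy0] cC hC cf.
pose approx (p : seq E * R) : set E :=
  [set x | C x /\ forall y, y \in p.1 -> Dhu x (f x) <= Dhu y (f x) + p.2].
pose D := [set p : seq E * R | (forall y, y \in p.1 -> C y) /\ 0 < p.2].
pose F := filter_from D approx.
have FF : ProperFilter F.
  apply: filter_from_proper.
    apply: filter_from_filter; first by exists ([::], 1).
    move=> [l a] [k b] [/= lC a0] [/= kC b0].
    exists (l ++ k, Num.min a b).
      split=> /= [y|]; last by rewrite lt_min a0.
      by rewrite mem_cat => /orP[/lC|/kC].
    move=> x [Cx /= xlk]; split; split=> //= y yl.
      by apply: le_trans (xlk y _) _; rewrite ?mem_cat ?yl// lerD2l ge_min lexx.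
    apply: le_trans (xlk y _) _; first by rewrite mem_cat yl orbT.
    by rewrite lerD2l ge_min lexx orbT.
  move=> [l a] [/= lC a0].
  have Cl (i : 'I_(size l).+1) : C (nth y0 (y0 :: l) i).
    have : nth y0 (y0 :: l) i \in y0 :: l by rewrite mem_nth.
    by rewrite inE => /predU1P[->|/lC].
  have [x Cx xP] := exists_approx_nearest cC hC cf Cl a0.
  exists x; split=> //= y yl.
  have yi : (index y (y0 :: l) < (size l).+1)%N.
    by rewrite index_mem inE yl orbT.
  by have := xP (Ordinal yi); rewrite /= nth_index// inE yl orbT.
have FC : F C by exists ([::], 1) => [|x []].
have [x [Cx clx]] := cC F FF FC.
exists x => // y Cy; apply/ler_addgt0Pr => e e0.
have e40 : 0 < e / 4%:R by rewrite divr_gt0.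
have [d d0 fd] := continuous_Dhu cf Cx e40.
have [] := clx (approx ([:: y], e / 4%:R))
  [set z | Dhu x z < Num.min d (e / 4%:R)].
- by exists ([:: y], e / 4%:R) => //; split=> //= z; rewrite inE => /eqP ->.
- by apply: nbhs_Dhu; rewrite lt_min d0.
move=> z [[Cz /= /(_ y)]]; rewrite inE eqxx lt_min => /(_ isT) zy /andP[xd xe].
have fxz := fd _ Cz xd.
have := Dhu_triangle z x (f x); have := Dhu_triangle (f z) z (f x).
have := Dhu_triangle (f x) y (f z); rewrite (Dhu_sym (f z) (f x)).
lra.
Qed.

(** A combination z of x and y never exceeds y by more than x does. If z is
    above x, the hypothesis therefore bounds the excess of y over x by that of y
    over z, and this puts the terms of z coming from y below x. If z is above y,
    it forces z to exceed y as much as x does, which takes a term x with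
    coefficient 0, so that z is above x after all. *)
Lemma segment_nearest x y z :
  maxplus_segment x y z -> Dhu x y <= Dhu z y -> z = x.
Proof.
move=> [m [v [t [vxy /bigmax_eq0P[t0 [j tj]] ->]]]]; set w := maxplus_comb v t.
move=> Dle; have vw i : v i + t i *: u <= w by apply: le_maxplus_comb.
have vjw : v j <= w by have := vw j; rewrite tj scale0r addr0.
have wyP : w <= y + pos_pu (x - y) *: u.
  apply: maxplus_comb_le => i; apply: le_trans (addZu_le _ (t0 i)) _.
  have [->|->] := vxy i; first exact: le_pos_pu.
  by rewrite -[leLHS]addr0 -[in leLHS](scale0r u) le_addZu ?pos_pu_ge0.
have Pw : pos_pu (w - y) <= pos_pu (x - y) by rewrite pos_pu_leP ?pos_pu_ge0.
(* A term y + t i u of w bounds the excess of y over w by - t i; the excess of y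
   over x is then bounded likewise, which puts the term below x. *)
have above_x : x <= w -> w = x.
  move=> xw; apply/eqP; rewrite eq_le xw andbT; apply: maxplus_comb_le => i.
  have [->|vi] := vxy i; first exact: addZu_le.
  have yw : y <= w + (- t i) *: u.
    have := le_addZuDl (- t i) (vw i).
    by rewrite subrr scale0r addr0 vi.
  have Qw : pos_pu (y - w) <= - t i by rewrite pos_pu_leP ?oppr_ge0.
  have Qx : pos_pu (y - x) <= - t i.
    by move: Dle Pw Qw; rewrite /Dhu; clear; lra.
  have := Qx; rewrite pos_pu_leP ?oppr_ge0// => /(le_addZuDr (t i)).
  by rewrite addNr scale0r addr0 vi.
have [vj|vj] := vxy j; first by apply: above_x; rewrite -vj.
rewrite vj in vjw.
have yw0 : pos_pu (y - w) <= 0 by rewrite pos_pu_leP// scale0r addr0.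
have [xy|xy] := pselect (x <= y); first by apply: above_x; apply: le_trans vjw.
have P0 : 0 < pos_pu (x - y).
  by rewrite ltNge; apply/negP; rewrite pos_pu_leP// scale0r addr0.
have [[i [vi ti]]|noi] := pselect (exists i, v i = x /\ t i = 0).
  by apply: above_x; have := vw i; rewrite vi ti scale0r addr0.
(* Now the terms x + t i u have t i < 0, so w exceeds y strictly less than x. *)
pose q := \big[Num.max/0]_(i < m.+1 | v i == x) (pos_pu (x - y) + t i).
have qP : q < pos_pu (x - y).
  apply: bigmax_lt => // i /eqP vi; rewrite gtrDl lt_neqAle t0 andbT.
  by apply/eqP => ti; apply: noi; exists i.
have q0 : 0 <= q by apply: bigmax_ge_id.
have wq : w <= y + q *: u.
  apply: maxplus_comb_le => i; have [vi|vi] := vxy i.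
    have iq : pos_pu (x - y) + t i <= q.
      by apply: (@le_bigmax_cond _ _ _ 0 i _ (fun k => _ + t k)); rewrite vi.
    apply: le_trans (le_addZu _ iq); rewrite vi.
    by apply: le_addZuDr; apply: le_pos_pu.
  apply: le_trans (addZu_le _ (t0 i)) _.
  by rewrite vi -[leLHS]addr0 -[in leLHS](scale0r u) le_addZu.
have wyq : pos_pu (w - y) <= q by rewrite pos_pu_leP.
have yx0 := pos_pu_ge0 (y - x).
exfalso; move: Dle yw0 qP wyq yx0; rewrite /Dhu; clear; lra.
Qed.

End Comb.

Theorem proposition9 (R : realType) (E : unitalRieszType R)
  (C : set E) (f : E -> E)
  (C_nonempty : C !=set0) (C_compact : compact C) (C_convex : maxplus_convex C)
  (f_continuous : {within C, continuous f})
  (E_complete : seq_complete E) :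
  (exists2 x0 : E, C x0 &
     forall y : E, C y -> Dhu x0 (f x0) <= Dhu y (f x0))
  /\
  ((forall x : E, C x -> x <> f x ->
      exists2 z : E, (C `&` maxplus_segment x (f x)) z & z <> x) ->
   exists2 x : E, C x & f x = x).
Proof.
have [x0 Cx0 x0min] :=
  exists_nearest C_nonempty C_compact C_convex f_continuous.
split; first by exists x0.
move=> move_toward; exists x0 => //; apply: contrapT => fx0.
have [z [Cz zseg]] := move_toward _ Cx0 (fun e => fx0 (esym e)); apply.
exact: segment_nearest zseg (x0min z Cz).
Qed.
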